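(* Let $R$ be a unital ring, and let $C$ and $D$ be countably generated projective right $R$-modules such that $D\subseteq C \subseteq R^n$ for some $n \in \mathbb{N}$ and $D$ is a pure submodule of $C$. Suppose that the matrix ring $M_n(R)$ is normal, and suppose there exist homomorphisms $\theta_1, \theta_2, \theta_3 \in K(R^n, C)$ such that $\theta_1 \ll \theta_2 \ll \theta_3$ and $\theta_1|_{D} = \mathrm{id}_D$. Then $D \subseteq C$ has a complement in $R^n$.
   Context: For right $R$-modules $P,Q$, $K(P,Q)$ is the subgroup of $\mathrm{Hom}_R(P,Q)$ generated by the maps $\theta_{q,\sigma}\colon p\mapsto q\,\sigma(p)$ with $q\in Q$, $\sigma\in P^*=\mathrm{Hom}_R(P,R)$; equivalently, the homomorphisms $P\to Q$ that factor through $R^m$ for some $m\in\mathbb{N}$. Elements of $K(R^n,C)$ are regarded as elements of $\mathrm{End}_R(R^n)\cong M_n(R)$ via $C\subseteq R^n$. In a ring $S$, for $a,b\in S$: $a\prec_l b$ means $ba=a$; $a\prec_r b$ means $ab=a$; $a\ll b$ means both $a\prec_l b$ and $a\prec_r b$. The ring $S$ is left normal if whenever $a\prec_l b\prec_l c$ in $S$ there are $d,e\in S$ with $a\prec_l d\prec_l e\prec_l c$; right normal is defined in the same way with $\prec_r$; $S$ is normal if it is both left and right normal. A submodule $N$ of a right $R$-module $M$ is pure if for every left $R$-module $X$ the map $N\otimes_R X\to M\otimes_R X$ induced by inclusion is injective. (When $M$ is projective this is equivalent to: for every finitely generated submodule $F\subseteq N$ there is a homomorphism $\sigma\colon M\to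 N$ with $\sigma|_F=\mathrm{id}_F$.) For countably generated right $R$-modules $D\subseteq C\subseteq R^n$, a complement of $D\subseteq C$ in $R^n$ is a countably generated submodule $E$ of $R^n$ such that $C+E=R^n$, $D\cap E=0$, and $D+E$ is a pure submodule of $R^n$. *)

(* Defs.v *)
From HB Require Import structures.
From mathcomp Require Import all_boot all_order all_algebra.
From mathcomp Require Import boolp.
From mathcomp Require Import freeg.

Set Implicit Arguments.
Unset Strict Implicit.
Unset Printing Implicit Defensive.

Import GRing.Theory.
Import Quotient.Exports.
Local Open Scope ring_scope.
Local Open Scope quotient_scope.

(* Rings are unital, not necessarily commutative, and possibly zero
   (pzRingType).  Left R-modules are lmodType R; right R-modules are left
   modules over the converse ring R^c, so that (r : R^c) *: x stands for the
   right action x r. *)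
Notation rmodType R := (lmodType R^c).

(* R^n as a right R-module: columns, on which matrices over R act on the left. *)
Notation rfree R n := 'cV[R^c]_n.

(* R as a right R-module. *)
Notation rreg R := (R^c)^o.

Section Ring.
Variable S : pzRingType.

Definition prec_l (a b : S) : Prop := b * a = a.
Definition prec_r (a b : S) : Prop := a * b = a.
Definition ll (a b : S) : Prop := prec_l a b /\ prec_r a b.

Definition left_normal : Prop := forall a b c : S,
  prec_l a b -> prec_l b c ->
  exists d e : S, [/\ prec_l a d, prec_l d e & prec_l e c].

Definition right_normal : Prop := forall a b c : S,
  prec_r a b -> prec_r b c ->
  exists d e : S, [/\ prec_r a d, prec_r d e & prec_r e c].

Definition normal_ring : Prop := left_normal /\ right_normal.
End Ring.

Section Submodule.
Variables (R : pzRingType) (V : lmodType R).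

Definition submod (N : submodClosed V) := {x : V | x \in N}.

HB.instance Definition _ (N : submodClosed V) := SubChoice.on (submod N).
HB.instance Definition _ (N : submodClosed V) :=
  [SubChoice_isSubLmodule of submod N by <:].

Definition submod_val (N : submodClosed V) : submod N -> V := val.

HB.instance Definition _ (N : submodClosed V) :=
  GRing.Linear.copy (@submod_val N) (val : submod N -> V).

Definition submod_incl (N M : submodClosed V) (NM : {subset N <= M})
    (x : submod N) : submod M :=
  exist _ (val x) (NM (val x) (valP x)).

Lemma submod_incl_is_linear (N M : submodClosed V) (NM : {subset N <= M}) :
  linear (submod_incl NM).
Proof. by move=> a x y; apply: val_inj. Qed.

HB.instance Definition _ (N M : submodClosed V) (NM : {subset N <= M}) :=
  GRing.isLinear.Build R (submod N) (submod M) *:%R (submod_incl NM)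
    (submod_incl_is_linear NM).

Definition sub_add (N M : submodClosed V) : {pred V} :=
  fun v => `[< exists x y, [/\ x \in N, y \in M & v = x + y] >].

Lemma sub_add_closed (N M : submodClosed V) : submod_closed (sub_add N M).
Proof.
split; first by apply/asboolP; exists 0, 0; rewrite !rpred0 addr0.
move=> a u v /asboolP[x [y [xN yM ->]]] /asboolP[x' [y' [x'N y'M ->]]].
apply/asboolP; exists (a *: x + x'), (a *: y + y').
by rewrite !rpredD ?rpredZ // scalerDr addrACA.
Qed.

HB.instance Definition _ (N M : submodClosed V) :=
  GRing.isSubmodClosed.Build R V (sub_add N M) (sub_add_closed N M).
End Submodule.

Definition countably_generated (R : pzRingType) (M : rmodType R) : Prop :=
  exists s : nat -> M, forall x : M,
    exists (m : nat) (r : 'I_m -> R^c), x = \sum_(i < m) r i *: s i.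

Definition projective (R : pzRingType) (P : rmodType R) : Prop :=
  forall (M N : rmodType R) (g : {linear M -> N}) (f : {linear P -> N}),
    (forall y, exists x, g x = y) ->
    exists h : {linear P -> M}, forall p, g (h p) = f p.

Section CompactHom.
Variables (R : pzRingType) (P Q : rmodType R).

Definition theta (q : Q) (sigma : {linear P -> rreg R}) (p : P) : Q :=
  (sigma p : R^c) *: q.

(* The additive subgroup of maps P -> Q generated by the theta q sigma; all its
   elements are R-linear. *)
Inductive inK : (P -> Q) -> Prop :=
| inK_theta q sigma : inK (theta q sigma)
| inK0 : inK (fun=> 0)
| inKB f g : inK f -> inK g -> inK (fun p => f p - g p).
End CompactHom.

Section Tensor.
Variables (R : pzRingType) (N : rmodType R) (X : lmodType R).

Inductive tensor_rel : {freeg (N * X)%type} -> Prop :=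
| tensor_relDl n n' x :
    tensor_rel (<<(n + n', x)>> - (<<(n, x)>> + <<(n', x)>>))
| tensor_relDr n x x' :
    tensor_rel (<<(n, x + x')>> - (<<(n, x)>> + <<(n, x')>>))
| tensor_relZ (r : R) n x :
    tensor_rel (<<((r : R^c) *: n, x)>> - <<(n, r *: x)>>)
| tensor_rel0 : tensor_rel 0
| tensor_relB u v : tensor_rel u -> tensor_rel v -> tensor_rel (u - v).

Definition tensor_null : {pred {freeg (N * X)%type}} :=
  fun u => `[< tensor_rel u >].

Lemma tensor_null_closed : zmod_closed tensor_null.
Proof.
split=> [|u v /asboolP Hu /asboolP Hv]; apply/asboolP; first exact: tensor_rel0.
exact: tensor_relB.
Qed.

HB.instance Definition _ :=
  GRing.isZmodClosed.Build {freeg (N * X)%type} tensor_null tensor_null_closed.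

Definition tensor : zmodType := Quotient.quot tensor_null.

Definition tens (n : N) (x : X) : tensor := \pi_(Quotient.quot tensor_null) <<(n, x)>>.
End Tensor.

Section TensorMap.
Variables (R : pzRingType) (N M : rmodType R) (X : lmodType R).
Variable f : {linear N -> M}.

Definition tensor_lift (u : {freeg (N * X)%type}) : {freeg (M * X)%type} :=
  fglift (fun p : N * X => <<(f p.1, p.2)>> : {freeg (M * X)%type}) u.

(* The map f (x) id_X : N (x) X -> M (x) X; by tensor_map_pi it does not depend
   on the representative picked by repr. *)
Definition tensor_map (t : tensor N X) : tensor M X :=
  \pi_(Quotient.quot (@tensor_null R M X)) (tensor_lift (repr t)).

Lemma tensor_liftU n x : tensor_lift <<(n, x)>> = <<(f n, x)>>.
Proof. by rewrite /tensor_lift liftU scale1r. Qed.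

Lemma tensor_liftB : {morph tensor_lift : u v / u - v}.
Proof. exact: lift_is_additive. Qed.

Lemma tensor_lift0 : tensor_lift 0 = 0.
Proof. by rewrite -(subrr 0) tensor_liftB subrr. Qed.

Lemma tensor_liftD : {morph tensor_lift : u v / u + v}.
Proof.
by move=> u v; rewrite -{1}[v]opprK -(sub0r v) !tensor_liftB tensor_lift0 sub0r opprK.
Qed.

Lemma tensor_lift_rel u : tensor_rel u -> tensor_rel (tensor_lift u).
Proof.
elim=> [n n' x|n x x'|r n x||{}u v _ Hu _ Hv].
- rewrite tensor_liftB tensor_liftD !tensor_liftU linearD.
  exact: tensor_relDl.
- rewrite tensor_liftB tensor_liftD !tensor_liftU.
  exact: tensor_relDr.
- rewrite tensor_liftB !tensor_liftU linearZ.
  exact: tensor_relZ.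
- by rewrite tensor_lift0; exact: tensor_rel0.
- by rewrite tensor_liftB; exact: tensor_relB.
Qed.

Lemma tensor_map_pi (u : {freeg (N * X)%type}) :
  tensor_map (\pi_(Quotient.quot (@tensor_null R N X)) u) =
  \pi_(Quotient.quot (@tensor_null R M X)) (tensor_lift u).
Proof.
apply/eqP; rewrite -Quotient.idealrBE -tensor_liftB.
apply/asboolP/tensor_lift_rel/asboolP.
suff: repr (\pi_(Quotient.quot (@tensor_null R N X)) u) - u \in @tensor_null R N X.
  by [].
by rewrite Quotient.idealrBE reprK.
Qed.

Lemma tensor_map_tens n x : tensor_map (tens n x) = tens (f n) x.
Proof. by rewrite /tens tensor_map_pi tensor_liftU. Qed.
End TensorMap.

(* For i the inclusion of a submodule. *)
Definition pure (R : pzRingType) (N M : rmodType R) (i : {linear N -> M}) : Prop :=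
  forall X : lmodType R, injective (@tensor_map R N M X i).

Section Free.
Variables (R : pzRingType) (n : nat).

(* The identification End_R(R^n) = M_n(R), see end_mxE. *)
Definition end_mx (f : {linear rfree R n -> rfree R n}) : 'M[R]_n :=
  \matrix_(i, j) f (delta_mx j 0) i 0.

Lemma end_mxE (f : {linear rfree R n -> rfree R n}) (v : rfree R n) :
  f v = end_mx f *m (v : 'cV[R]_n).
Proof.
transitivity (f (\sum_k v k 0 *: (delta_mx k 0 : rfree R n))).
  by congr (f _); rewrite [LHS]matrix_sum_delta; apply: eq_bigr => k _; rewrite big_ord1.
rewrite linear_sum; apply/colP=> i; rewrite summxE [RHS]mxE.
by apply: eq_bigr => k _; rewrite linearZ !mxE.
Qed.

Lemma end_mx_comp (f g : {linear rfree R n -> rfree R n}) :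
  end_mx (f \o g) = end_mx f * end_mx g.
Proof.
apply/matrixP=> i j; rewrite [LHS]mxE /= end_mxE [LHS]mxE [RHS]mxE.
by apply: eq_bigr => k _; congr (_ * _); rewrite [RHS]mxE.
Qed.

Definition sub_mx (C : submodClosed (rfree R n)) (f : {linear rfree R n -> submod C}) :
    'M[R]_n :=
  end_mx (@submod_val _ _ C \o f).

Definition complement (C D E : submodClosed (rfree R n)) : Prop :=
  [/\ countably_generated (submod E),
      forall v : rfree R n, v \in sub_add C E,
      forall v : rfree R n, v \in D -> v \in E -> v = 0
    & pure (@submod_val _ _ (sub_add D E))].
End Free.

(* Main.v *)
From HB Require Import structures.
Require Import Defs.
From mathcomp Require Import all_boot all_order all_algebra.
From mathcomp Require Import boolp.
From mathcomp Require Import freeg.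

(** The idea is to find E inside the kernel of theta1, which is the identity on
D, and yet so large that C + E is everything.

Passing to complements reverses the order: theta1 << theta2 << theta3 gives
1 - theta3 <_l 1 - theta2 <_l 1 - theta1.  Left normality interpolates again
and again ([left_normal_chain]) and produces a sequence
   1 - theta3 <_l d_0 <_l d_1 <_l ...
all of whose terms are <_l 1 - theta1.  Take E to be the union of the images
d_k R^n; this union is increasing because d_(k+1) d_k = d_k.

- The columns of all the d_k generate E ([countably_generated_im_union]).
- v = theta3 v + (1 - theta3) v, where theta3 v lies in C and
  (1 - theta3) v = d_0 (1 - theta3) v lies in E; so C + E = R^n.
- (1 - theta1) d_k = d_k says theta1 d_k = 0, so theta1 vanishes on E.  As it is
  the identity on D, the intersection of D and E is 0.
- E is pure in R^n: d_(k+1) maps R^n to E and fixes d_k R^n, so a tensor over E,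
  which involves finitely many elements of E, can be recovered from its image
  over R^n ([pure_retracts]).
- D + E is pure in R^n ([pure_sub_add]).  A tensor over D + E is a sum of a
  tensor s over D and a tensor t over E.  If its image over R^n is 0, then
  applying theta1 shows that the image of s over C is 0, hence s = 0 by purity
  of D in C; what remains is t, which is 0 by purity of E. *)

Set Implicit Arguments.
Unset Strict Implicit.
Unset Printing Implicit Defensive.

Import GRing.Theory.
Import Quotient.Exports.
Local Open Scope ring_scope.
Local Open Scope quotient_scope.

(** * Tensor products *)

Section TensorTheory.
Variables (R : pzRingType) (X : lmodType R).
Implicit Types N M L : rmodType R.

Lemma tensDl N (n n' : N) (x : X) : tens (n + n') x = tens n x + tens n' x.
Proof.
rewrite /tens -raddfD; apply/eqP; rewrite -Quotient.idealrBE.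
by apply/asboolP; exact: tensor_relDl.
Qed.

(** A tensor product is generated as an additive group by pure tensors; with
this, statements about tensors reduce to elements of the module. *)
Lemma tensor_ind N (P : tensor N X -> Prop) :
  (forall n x, P (tens n x)) -> (forall s t, P s -> P t -> P (s - t)) ->
  forall t, P t.
Proof.
move=> Ptens PB.
have P0 : P 0 by rewrite -(subrr (tens 0 0)); apply: PB.
have PN s : P s -> P (- s) by move=> Ps; rewrite -[- s]sub0r; apply: PB.
have PD s t : P s -> P t -> P (s + t).
  by move=> Ps Pt; rewrite -[t]opprK; apply/PB/PN.
suff Ppi (u : {freeg (N * X)%type}) :
    P (\pi_(Quotient.quot (@tensor_null R N X)) u).
  by move=> t; rewrite -[t]reprK.
elim/freeg_ind_dom0: u => [|k [n x] u _ _ Pu]; first by rewrite raddf0.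
rewrite raddfD; apply: (PD) => // {u Pu}.
have Pnat (m : nat) :
    P (\pi_(Quotient.quot (@tensor_null R N X)) << m%:Z *g (n, x) >>).
  elim: m => [|m IHm]; first by rewrite freegU0 raddf0.
  by rewrite intS -freegUD raddfD; apply: (PD) => //; apply: Ptens.
by case: (intP k) => [|m|m]; rewrite -?freegUN ?raddfN; do ?apply: PN; apply: Pnat.
Qed.

Section Map.
Variables (N M : rmodType R) (f : {linear N -> M}).

Lemma tensor_map_is_zmod_morphism : zmod_morphism (@tensor_map R N M X f).
Proof.
move=> s t; rewrite -[s]reprK -[t]reprK -raddfB !tensor_map_pi.
by rewrite tensor_liftB raddfB.
Qed.

HB.instance Definition _ :=
  GRing.isZmodMorphism.Build _ _ (@tensor_map R N M X f)
    tensor_map_is_zmod_morphism.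

Lemma tensor_map0 : tensor_map (X := X) f 0 = 0.
Proof. exact: raddf0. Qed.

Lemma tensor_mapB (s t : tensor N X) :
  tensor_map f (s - t) = tensor_map f s - tensor_map f t.
Proof. exact: raddfB. Qed.

Lemma tensor_mapD (s t : tensor N X) :
  tensor_map f (s + t) = tensor_map f s + tensor_map f t.
Proof. exact: raddfD. Qed.

Lemma tensor_map_inj : (forall t : tensor N X, tensor_map f t = 0 -> t = 0) ->
  injective (@tensor_map R N M X f).
Proof. exact: raddf_inj. Qed.
End Map.

(** Functoriality, with the composite given up to pointwise equality: many of
the composites of inclusions and corestrictions used below are maps that already
have another name. *)
Lemma tensor_map_comp N M L (g : {linear M -> L}) (f : {linear N -> M})
    (h : {linear N -> L}) :
  (forall x, g (f x) = h x) ->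
  forall t : tensor N X, tensor_map g (tensor_map f t) = tensor_map h t.
Proof.
move=> gf; elim/tensor_ind => [n x|s t IHs IHt]; last by rewrite !tensor_mapB IHs IHt.
by rewrite !tensor_map_tens gf.
Qed.

Lemma tensor_map_zero N M (f : {linear N -> M}) :
  (forall x, f x = 0) -> forall t : tensor N X, tensor_map f t = 0.
Proof.
move=> f0; elim/tensor_ind => [n x|s t fs ft]; last by rewrite tensor_mapB fs ft subr0.
by rewrite tensor_map_tens f0; apply: (addrI (tens 0 x)); rewrite -tensDl !addr0.
Qed.

End TensorTheory.

(** * Purity *)

Section Corestrict.
Variables (R : pzRingType) (V W : rmodType R) (N : submodClosed W).
Variables (f : {linear V -> W}) (fN : forall v, f v \in N).

Definition corestrict (v : V) : submod N := exist _ (f v) (fN v).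

Lemma corestrict_is_linear : linear corestrict.
Proof. by move=> a u v; apply: val_inj; rewrite /= linearP. Qed.

HB.instance Definition _ :=
  GRing.isLinear.Build R^c V (submod N) *:%R corestrict corestrict_is_linear.
End Corestrict.

Section Purity.
Variables (R : pzRingType) (V : rmodType R).

(** An element x of E need not be fixed by one p common to all of E, but a tensor
only involves finitely many elements, so some p m fixes them all and then maps
the image of the tensor over V back to it.  Asking for all large m, instead of a
single one, is what allows finitely many indices to be merged. *)
Lemma pure_retracts (E : submodClosed V) (p : nat -> {linear V -> submod E}) :
  (forall x : submod E, exists k, forall m, (k <= m)%N -> p m (val x) = x) ->
  pure (@submod_val _ _ E).
Proof.
move=> pE X; apply: tensor_map_inj => t t0.
have [k /(_ k (leqnn k)) <-] : exists k, forall m, (k <= m)%N ->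
    tensor_map (p m) (tensor_map (@submod_val _ _ E) t) = t.
  elim/tensor_ind: {t0} t => [x y|s t [k Hs] [l Ht]].
    have [k pk] := pE x; exists k => m km.
    by rewrite !tensor_map_tens pk.
  exists (maxn k l) => m; rewrite geq_max => /andP[km lm].
  by rewrite !tensor_mapB Hs ?Ht.
by rewrite t0 tensor_map0.
Qed.

Lemma sub_addl (N M : submodClosed V) : {subset N <= sub_add N M}.
Proof. by move=> x xN; apply/asboolP; exists x, 0; rewrite addr0 rpred0. Qed.

Lemma sub_addr (N M : submodClosed V) : {subset M <= sub_add N M}.
Proof. by move=> x xM; apply/asboolP; exists 0, x; rewrite add0r rpred0. Qed.

(** The map p separates the two summands: it sees the D-part of a tensor, over C,
and kills the E-part. *)
Lemma pure_sub_add (C D E : submodClosed V) (DC : {subset D <= C})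
    (p : {linear V -> submod C}) :
    pure (submod_incl DC) -> pure (@submod_val _ _ E) ->
    (forall x, x \in D -> val (p x) = x) -> (forall x, x \in E -> p x = 0) ->
  pure (@submod_val _ _ (sub_add D E)).
Proof.
move=> D_pure E_pure pD pE X; apply: tensor_map_inj => t.
have [tD [tE ->]] : exists tD tE, t = tensor_map (submod_incl (@sub_addl D E)) tD
    + tensor_map (submod_incl (@sub_addr D E)) tE.
  elim/tensor_ind: t => [[v vDE] x|s t [sD [sE ->]] [tD [tE ->]]]; last first.
    by exists (sD - tD), (sE - tE); rewrite !tensor_mapB opprD addrACA.
  have /asboolP[y [z [yD zE v_yz]]] := vDE.
  exists (tens (exist _ y yD : submod D) x), (tens (exist _ z zE : submod E) x).
  by rewrite !tensor_map_tens -tensDl; congr tens; apply: val_inj.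
rewrite tensor_mapD => t0.
pose iDE := @submod_val _ _ (sub_add D E).
have tD0 : tD = 0.
  apply: D_pure; rewrite tensor_map0.
  (* The image of tD over C is the image under p of the whole tensor. *)
  have := congr1 (tensor_map p) t0; rewrite tensor_map0 tensor_mapD => <-.
  rewrite (tensor_map_comp (h := iDE \o submod_incl (@sub_addl D E)))//.
  rewrite (tensor_map_comp (h := submod_incl DC)) => [|[x xD]]; last first.
    by apply: val_inj; apply: pD.
  rewrite (tensor_map_comp (h := iDE \o submod_incl (@sub_addr D E)))//.
  pose pE_map := p \o (iDE \o submod_incl (@sub_addr D E)).
  have pE0 (x : submod E) : pE_map x = 0 by exact: (pE _ (valP x)).
  by rewrite (tensor_map_comp (h := pE_map))// (tensor_map_zero pE0) addr0.
move: t0; rewrite tD0 !tensor_map0 !add0r.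
rewrite (tensor_map_comp (h := @submod_val _ _ E))// => tE0.
by rewrite (_ : tE = 0) ?tensor_map0//; apply: E_pure; rewrite tE0 tensor_map0.
Qed.
End Purity.

(** * Countable generation *)

Section CountableGeneration.
Variables (R : pzRingType) (M : rmodType R) (s : nat -> M).

(** The combinations allowed in the definition of countable generation are over
an initial segment of the generators; the lemmas of this section show that this
is no restriction. *)
Definition prefix_span (x : M) : Prop :=
  exists (m : nat) (r : 'I_m -> R^c), x = \sum_(i < m) r i *: s i.

Lemma prefix_combination_widen m (r : 'I_m -> R^c) m' : (m <= m')%N ->
  exists r' : 'I_m' -> R^c, \sum_(i < m) r i *: s i = \sum_(i < m') r' i *: s i.
Proof.
move/subnKC <-; set k := (m' - m)%N.
exists (fun i => if split i is inl j then r j else 0).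
rewrite big_split_ord /= [X in _ = _ + X]big1 => [|i _]; last first.
  by rewrite (unsplitK (inr i)) scale0r.
by rewrite addr0; apply: eq_bigr => i _; rewrite (unsplitK (inl i)).
Qed.

Lemma prefix_span_gen i : prefix_span (s i).
Proof.
exists i.+1, (fun j => (j == ord_max)%:R).
rewrite (bigD1 ord_max)//= eqxx scale1r big1 ?addr0// => j /negPf->.
by rewrite scale0r.
Qed.

Lemma prefix_span_sum m (r : 'I_m -> R^c) (x : 'I_m -> M) :
  (forall i, prefix_span (x i)) -> prefix_span (\sum_(i < m) r i *: x i).
Proof.
move=> xs; elim/big_ind: _ => [|u v|i _].
- by exists 0, (fun=> 0); rewrite big_ord0.
- move=> [k [q ->]] [l [q' ->]].
  have [p ->] := prefix_combination_widen q (leq_maxl k l).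
  have [p' ->] := prefix_combination_widen q' (leq_maxr k l).
  exists (maxn k l), (fun i => p i + p' i); rewrite -big_split/=.
  by apply: eq_bigr => i _; rewrite scalerDl.
- have [k [q ->]] := xs i; exists k, (fun j => r i * q j).
  by rewrite scaler_sumr; apply: eq_bigr => j _; rewrite scalerA.
Qed.
End CountableGeneration.

(** * Increasing unions of images *)

Section LinearUnion.
Variables (R : pzRingType) (V : rmodType R) (h : nat -> {linear V -> V}).
(* This is h k <_l h k.+1 in the endomorphism ring; it makes the images increase,
and makes h k.+1 the identity on the image of h k. *)
Hypothesis hS : forall k v, h k.+1 (h k v) = h k v.

Lemma telescope_absorb k m v : (k < m)%N -> h m (h k v) = h k v.
Proof.
elim: m => // m IHm; rewrite ltnS leq_eqVlt => /orP[/eqP->//|km].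
by rewrite -{1}(IHm km) hS IHm.
Qed.

Definition im_union : {pred V} := fun x => `[< exists k v, x = h k v >].

Lemma mem_im_union k v : h k v \in im_union.
Proof. by apply/asboolP; exists k, v. Qed.

Lemma im_union_closed : submod_closed im_union.
Proof.
split; first by rewrite -(linear0 (h 0)) mem_im_union.
move=> a u v /asboolP[k [u' ->]] /asboolP[l [v' ->]].
rewrite -(@telescope_absorb k (maxn k l).+1) ?ltnS ?leq_maxl//.
rewrite -(@telescope_absorb l (maxn k l).+1) ?ltnS ?leq_maxr//.
by rewrite -linearP mem_im_union.
Qed.

Definition im_union_submod : submodClosed V :=
  HB.pack im_union (GRing.isSubmodClosed.Build R^c V im_union im_union_closed).

Lemma pure_im_union : pure (@submod_val _ _ im_union_submod).
Proof.
pose p k : {linear V -> submod im_union_submod} :=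
  corestrict (N := im_union_submod) (mem_im_union k).
apply: (@pure_retracts _ _ _ p) => -[x xE].
have /asboolP[k [v x_def]] := xE.
exists k.+1 => m km; apply: val_inj; rewrite /= x_def.
exact: telescope_absorb.
Qed.

Lemma countably_generated_im_union :
  countably_generated V -> countably_generated (submod im_union_submod).
Proof.
move=> [s s_gen].
pose p k : {linear V -> submod im_union_submod} :=
  corestrict (N := im_union_submod) (mem_im_union k).
pose s' j := if unpickle j is Some (k, i) then p k (s i) else 0.
exists s' => -[x xE]; have /asboolP[k [v x_def]] := xE.
have -> : exist _ x xE = p k v by apply: val_inj.
have [m [r ->]] := s_gen v.
rewrite linear_sum /=; under eq_bigr do rewrite linearZ /=.
apply: prefix_span_sum => i.
have -> : p k (s i) = s' (pickle (k, i : nat)) by rewrite /s' pickleK.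
exact: prefix_span_gen.
Qed.
End LinearUnion.

(** * Interpolation in left normal rings *)

Section Order.
Variable S : pzRingType.
Implicit Types a b c : S.

Lemma prec_l_trans a b c : prec_l a b -> prec_l b c -> prec_l a c.
Proof. by rewrite /prec_l => ab bc; rewrite -ab mulrA bc. Qed.

(** ab = a is equivalent to (1 - a)(1 - b) = 1 - b: complements turn the right
order into the reversed left one. *)
Lemma prec_r_compl a b : prec_r a b -> prec_l (1 - b) (1 - a).
Proof.
by rewrite /prec_l /prec_r => ab; rewrite mulrBl mul1r mulrBr mulr1 ab subrr subr0.
Qed.

Lemma prec_l_compl_mul0 a b : prec_l b (1 - a) -> a * b = 0.
Proof.
rewrite /prec_l mulrBl mul1r => /eqP.
by rewrite subr_eq addrC -subr_eq subrr eq_sym => /eqP.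
Qed.

(** One interpolation yields two new elements, so that the pair (d, e) with
d <_l e <_l c is again of the form to which normality applies.  Iterating on such
pairs, and keeping the first components, gives the sequence. *)
Lemma left_normal_chain a b c :
  left_normal S -> prec_l a b -> prec_l b c ->
  exists d : nat -> S, [/\ prec_l a (d 0),
    forall k, prec_l (d k) (d k.+1) & forall k, prec_l (d k) c].
Proof.
move=> S_normal ab bc.
pose ok (x : S * S) := prec_l x.1 x.2 /\ prec_l x.2 c.
have step (x : {x | ok x}) : exists y : {x | ok x},
    prec_l (proj1_sig x).1 (proj1_sig y).1.
  case: x => -[x y] [/= xy yc]; have [d [e [xd de ec]]] := S_normal _ _ _ xy yc.
  by exists (exist _ (d, e) (conj de ec)).
have [f fP] := choice step.
have [d [e [ad de ec]]] := S_normal _ _ _ ab bc.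
pose y k := iter k f (exist ok (d, e) (conj de ec)).
exists (fun k => (proj1_sig (y k)).1); split=> [||k]; first exact: ad.
  by move=> k; exact: (fP (y k)).
by have [] := proj2_sig (y k); apply: prec_l_trans.
Qed.
End Order.

(** * Matrices acting on columns *)

Section Columns.
Variables (R : pzRingType) (n : nat).

Definition mx_end (d : 'M[R]_n) (v : rfree R n) : rfree R n := d *m (v : 'cV[R]_n).

Lemma mx_end_is_linear d : linear (mx_end d).
Proof.
move=> a u v; rewrite /mx_end [LHS]mulmxDr; congr (_ + _).
apply/colP => i; rewrite [LHS]mxE [RHS]mxE.
rewrite [(d *m _) i 0]mxE [RHS]mulr_suml.
by apply: eq_bigr => k _; rewrite mxE; apply: (@mulrA R).
Qed.

HB.instance Definition _ d :=
  GRing.isLinear.Build R^c (rfree R n) (rfree R n) *:%R (mx_end d)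
    (mx_end_is_linear d).

Lemma mx_endM d e v : mx_end (d * e) v = mx_end d (mx_end e v).
Proof. by rewrite /mx_end [d * e]/(d *m e) mulmxA. Qed.

Lemma countably_generated_rfree : countably_generated (rfree R n).
Proof.
exists (fun i => if insub i is Some j then delta_mx j 0 else 0) => v.
exists n, (fun i => v i 0).
rewrite [LHS]matrix_sum_delta; apply: eq_bigr => i _.
by rewrite big_ord1 valK.
Qed.
End Columns.

Theorem proposition5p14 (R : pzRingType) (n : nat)
    (C D : submodClosed (rfree R n)) (DC : {subset D <= C})
    (C_cg : countably_generated (submod C)) (C_proj : projective (submod C))
    (D_cg : countably_generated (submod D)) (D_proj : projective (submod D))
    (D_pure : pure (submod_incl DC))
    (Mn_normal : normal_ring 'M[R]_n)
    (theta_exist : exists theta1 theta2 theta3 : {linear rfree R n -> submod C},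
      [/\ inK theta1, inK theta2, inK theta3,
          ll (sub_mx theta1) (sub_mx theta2)
        & ll (sub_mx theta2) (sub_mx theta3)] /\
      forall d : rfree R n, d \in D -> submod_val (theta1 d) = d) :
  exists E : submodClosed (rfree R n), complement C D E.
Proof.
have [t1 [t2 [t3 [[_ _ _ [_ t12] [_ t23]] t1D]]]] := theta_exist.
have [d [ad dS dc]] := left_normal_chain (proj1 Mn_normal)
  (prec_r_compl t23) (prec_r_compl t12).
have hS k v : mx_end (d k.+1) (mx_end (d k) v) = mx_end (d k) v.
  by rewrite -mx_endM dS.
have sub_mxE (t : {linear rfree R n -> submod C}) v :
    val (t v) = mx_end (sub_mx t) v.
  exact: (end_mxE (@submod_val _ _ C \o t) v).
have complE (a : 'M[R]_n) v : mx_end (1 - a) v = v - mx_end a v.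
  by rewrite /mx_end mulmxBl mul1mx.
pose E := im_union_submod hS.
have t1E x : x \in E -> t1 x = 0.
  move=> /asboolP[k [v ->]]; apply: val_inj; rewrite sub_mxE.
  by rewrite -mx_endM (prec_l_compl_mul0 (dc k)) /mx_end mul0mx.
exists E; split.
- exact/countably_generated_im_union/countably_generated_rfree.
- move=> v; apply/asboolP.
  (* v = theta3 v + (1 - theta3) v, and d 0 fixes the range of 1 - theta3. *)
  exists (val (t3 v)), (mx_end (d 0) (mx_end (1 - sub_mx t3) v)); split.
  + exact: valP.
  + exact: mem_im_union.
  + by rewrite -mx_endM ad complE sub_mxE addrC subrK.
- by move=> v vD /t1E tv0; rewrite -(t1D v vD) tv0.
- exact: (@pure_sub_add _ _ C D E DC t1 D_pure (@pure_im_union _ _ _ hS) t1D t1E).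
Qed.
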